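(* Let $r\ge1$ and $n\ge 1$ be integers, and let $\mu_r=1+w^{r/2}$ if $r$ is even, $\mu_r=1$ if $r$ is odd. Then the polynomial $f_{r,1,n}(u,v,w)=\sum_{\pi\in I_{r,1,n}}u^{\mathrm{fix}(\pi)}v^{\mathrm{exc}_A(\pi)}w^{\mathrm{csum}(\pi)}$ is given by $$f_{r,1,n}(u,v,w)=\sum_{j=\lceil n/2\rceil}^n (n-j)!\binom{n}{n-j,\ n-j,\ 2j-n}\frac{u^{2j-n}\left(v+(r-1)w^r\right)^{n-j}}{2^{n-j}}\,\mu_r^{2j-n}.$$
   Context: Let $\Sigma=\{i^{[c]} : 1\le i\le n,\ c\in\mathbb{Z}_r\}$ be the set $[n]=\{1,\dots,n\}$ coloured with colours $0,1,\dots,r-1$; write $i$ for $i^{[0]}$. The group $G_{r,n}=\mathbb{Z}_r\wr S_n$ of coloured permutations consists, under composition, of all bijections $\sigma:\Sigma\to\Sigma$ for which there are a permutation $|\sigma|\in S_n$ and integers $z_1(\sigma),\dots,z_n(\sigma)\in\{0,\dots,r-1\}$ with $\sigma(i^{[c]})=(|\sigma|(i))^{[c+z_i(\sigma)]}$ (colours added modulo $r$). Put $\mathrm{csum}(\sigma)=\sum_{i=1}^n z_i(\sigma)$, an integer. $I_{r,1,n}$ is the set of involutions of $G_{r,1,n}=G_{r,n}$, i.e. elements $\pi$ with $\pi^2=1$ (the identity included). The colour order on $\Sigma$ is $1^{[r-1]}<\cdots<n^{[r-1]}<1^{[r-2]}<\cdots<n^{[r-2]}<\cdots<1<\cdots<n$.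 Define $\mathrm{exc}_A(\sigma)=|\{i\in[n-1] : \sigma(i)>i\}|$ (comparison in the colour order). $\mathrm{fix}(\sigma)$ denotes the number of absolute fixed points, i.e. of $i\in[n]$ with $|\sigma|(i)=i$. Multinomial coefficients: $\binom{n}{a,b,c}=\frac{n!}{a!\,b!\,c!}$. *)

(* Defs.v *)
From HB Require Import structures.
From mathcomp Require Import all_boot all_order all_algebra all_fingroup.
From mathcomp Require Import mpoly.

Set Implicit Arguments.
Unset Strict Implicit.
Unset Printing Implicit Defensive.

Import GRing.Theory.
Local Open Scope ring_scope.

(* The colour group Z_r, for r >= 1. The type ['Z_r] is not used because it has
   two elements when r = 1. *)
Definition colour (r : nat) : finZmodType := 'I_r.-1.+1.

(* The pair (i, c) is the letter (i+1)^[c]: letters are numbered from 0. *)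
Definition letter (r n : nat) : finType := ('I_n * colour r)%type.

(* Strict colour order: larger colours come first, and letters of the same
   colour are in their natural order. *)
Definition colour_lt (r n : nat) (x y : letter r n) : bool :=
  (nat_of_ord y.2 < nat_of_ord x.2)%N || ((x.2 == y.2) && (x.1 < y.1)%N).

Definition coloured_perms (r n : nat) : {set {perm letter r n}} :=
  [set sigma : {perm letter r n} |
    [exists s : {perm 'I_n}, exists z : {ffun 'I_n -> colour r},
      forall i : 'I_n, forall c : colour r,
        sigma (i, c) == (s i, c + z i)]].

(* |sigma|(i) and z_i(sigma), read off from sigma(i^[0]); that they are the data
   of the definition of [coloured_perms] is [coloured_permsE] below. *)
Definition abs_fun (r n : nat) (sigma : {perm letter r n}) (i : 'I_n) : 'I_n :=
  (sigma (i, 0)).1.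

Definition col (r n : nat) (sigma : {perm letter r n}) (i : 'I_n) : colour r :=
  (sigma (i, 0)).2.

Lemma coloured_permsE (r n : nat) (sigma : {perm letter r n})
    (s : 'I_n -> 'I_n) (z : 'I_n -> colour r) :
  (forall i c, sigma (i, c) = (s i, c + z i)) ->
  abs_fun sigma =1 s /\ col sigma =1 z.
Proof.
by move=> H; split=> i; rewrite /abs_fun /col H //= add0r.
Qed.

Definition csum (r n : nat) (sigma : {perm letter r n}) : nat :=
  (\sum_(i < n) nat_of_ord (col sigma i))%N.

(* The numbers 1, ..., n-1 are the i : 'I_n with i < n.-1, numbering from 0. *)
Definition excA (r n : nat) (sigma : {perm letter r n}) : nat :=
  #|[set i : 'I_n | (i < n.-1)%N && colour_lt (i, 0) (sigma (i, 0))]|.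

Definition fixn (r n : nat) (sigma : {perm letter r n}) : nat :=
  #|[set i : 'I_n | abs_fun sigma i == i]|.

Definition involutions (r n : nat) : {set {perm letter r n}} :=
  [set sigma in coloured_perms r n | (sigma * sigma == 1)%g].

Definition u : {mpoly rat[3]} := 'X_(@Ordinal 3 0 isT).
Definition v : {mpoly rat[3]} := 'X_(@Ordinal 3 1 isT).
Definition w : {mpoly rat[3]} := 'X_(@Ordinal 3 2 isT).

Definition inv_poly (r n : nat) : {mpoly rat[3]} :=
  \sum_(sigma in involutions r n)
    u ^+ fixn sigma * v ^+ excA sigma * w ^+ csum sigma.

Definition mu (r : nat) : {mpoly rat[3]} :=
  if odd r then 1 else 1 + w ^+ r./2.

Definition multinomial3 (n a b c : nat) : rat :=
  n`!%:R / (a`!%:R * b`!%:R * c`!%:R).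

(* Main.v *)
(* A coloured involution is an involution s of [n] with colours z such that
   z (s i) = - z i. For fixed s the colours are free on each cycle: a fixed point
   needs 2 z = 0 and contributes mu r, a 2-cycle i < s i has one free colour and
   contributes v if it is 0 (i is then an excedance) and w ^ r otherwise (the two
   colours add up to r). It remains to count the involutions with k 2-cycles,
   which is done by induction on k, multiplying by transpositions. *)
Require Import Defs.
From HB Require Import structures.
From mathcomp Require Import all_boot all_order all_algebra all_fingroup.
From mathcomp Require Import mpoly.
From mathcomp Require Import zify ring.

Set Implicit Arguments.
Unset Strict Implicit.
Unset Printing Implicit Defensive.

Import GRing.Theory.
Local Open Scope ring_scope.

(** * Counting involutions of a finite set by their moved points *)

Section CountInvolutions.
Variable T : finType.
Implicit Types (s : {perm T}) (i j : T).

Definition moved s : {set T} := [set i | s i != i].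

Definition involutions_moving (m : nat) : {set {perm T}} :=
  [set s | (s * s == 1)%g && (#|moved s| == m)].

Lemma involP s : reflect (involutive s) (s * s == 1)%g.
Proof.
apply: (iffP eqP) => [ss i|ss]; first by rewrite -permM ss perm1.
by apply/permP => i; rewrite permM ss perm1.
Qed.

(** If [s] exchanges [i] and [j], it commutes with [tperm i j], so the product has the same square;
    its moved points are those of [s] without [i] and [j]. *)
Lemma tperm_mul_involving s i j (m : nat) : i != j ->
  (s \in involutions_moving m.+2) && (s i == j) =
  ((tperm i j * s)%g \in involutions_moving m) &&
    (((tperm i j * s)%g i == i) && ((tperm i j * s)%g j == j)).
Proof.
move=> ij; rewrite !inE !permM tpermL tpermR.
(* Products act left to right, so the two conditions on the right now read [s j = i] and
   [s i = j]. *)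
have [sij|] := eqVneq (s i) j; last by rewrite !andbF.
have [sji|sji] := eqVneq (s j) i; last first.
  rewrite !andbF !andbT; apply/negbTE; apply: contra sji.
  by case/andP => /involP ss _; rewrite -sij ss.
rewrite !andbT; have comm : commute (tperm i j) s.
  apply/permP => x; rewrite !permM.
  case: tpermP => [->|->|/eqP xi /eqP xj]; rewrite ?sij ?sji ?tpermL ?tpermR //.
  by rewrite tpermD //; [rewrite -sji | rewrite -sij]; rewrite (inj_eq perm_inj) eq_sym.
have -> : (tperm i j * s * (tperm i j * s) = s * s)%g.
  by rewrite mulgA -(mulgA _ s) -comm mulgA tperm2 mul1g.
congr (_ && _).
have -> : moved s = i |: (j |: moved (tperm i j * s)%g).
  apply/setP => x; rewrite !inE permM.
  case: tpermP => [->|->|/eqP/negbTE-> /eqP/negbTE->] //;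
    by rewrite ?sij ?sji ?eqxx ?orbT // eq_sym.
by rewrite !cardsU1 !inE !permM tpermL tpermR sij sji !eqxx (negbTE ij).
Qed.

Lemma sum_moved_pairs s :
  (\sum_(p : T * T | p.1 != p.2) (s p.1 == p.2))%N = #|moved s|.
Proof.
rewrite -(pair_big_dep xpredT (fun i j => i != j) (fun i j => (s i == j) : nat)) /=.
rewrite -sum1_card [RHS]big_mkcond; apply: eq_bigr => i _ /=.
rewrite inE; case: eqVneq => [sii|sii] /=.
  by rewrite big1 // => j ij; rewrite sii (negbTE ij).
rewrite (bigD1 (s i)) ?(eq_sym i) //= eqxx big1 // => j /andP[_ sij].
by rewrite eq_sym (negbTE sij).
Qed.

Lemma sum_fixed_pairs s :
  (\sum_(p : T * T | p.1 != p.2) ((s p.1 == p.1) && (s p.2 == p.2)))%N =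
  (#|~: moved s| * #|~: moved s|.-1)%N.
Proof.
rewrite -(pair_big_dep xpredT (fun i j => i != j)
            (fun i j => ((s i == i) && (s j == j)) : nat)) /=.
rewrite -sum_nat_const [RHS]big_mkcond; apply: eq_bigr => i _ /=.
rewrite !inE negbK; case: eqP => [sii|_]; last by rewrite big1.
have -> : #|~: moved s|.-1 = #|(~: moved s) :\ i|.
  by rewrite (cardsD1 i (~: _)) !inE sii eqxx.
rewrite -sum1_card big_mkcond [RHS]big_mkcond; apply: eq_bigr => j _ /=.
by rewrite !inE negbK eq_sym; case: (j != i); case: (s j == j).
Qed.

Lemma card_fixed s (m : nat) :
  s \in involutions_moving m -> #|~: moved s| = (#|T| - m)%N.
Proof. by rewrite inE => /andP[_ /eqP<-]; rewrite -(cardsC (moved s)) addKn. Qed.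

(* Both sides count the triples (s, i, j) with i <> j: s exchanges i and j on
   the left, fixes both on the right, and composing with the transposition of
   i and j passes from one kind of triple to the other. *)
Lemma card_involutions_moving_rec (m : nat) :
  (#|involutions_moving m.+2| * m.+2 =
   #|involutions_moving m| * ((#|T| - m) * (#|T| - m).-1))%N.
Proof.
transitivity (\sum_(s in involutions_moving m.+2)
    \sum_(p : T * T | p.1 != p.2) (s p.1 == p.2))%N.
  rewrite -sum_nat_const; apply: eq_bigr => s; rewrite sum_moved_pairs.
  by rewrite inE => /andP[_ /eqP].
transitivity (\sum_(s in involutions_moving m)
    \sum_(p : T * T | p.1 != p.2) ((s p.1 == p.1) && (s p.2 == p.2)))%N; last first.
  rewrite -sum_nat_const; apply: eq_bigr => s /card_fixed <-.
  exact: sum_fixed_pairs.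
rewrite exchange_big [RHS]exchange_big; apply: eq_bigr => -[i j] /= ij.
rewrite [RHS](reindex_inj (mulgI (tperm i j))) /=.
rewrite big_mkcond [RHS]big_mkcond; apply: eq_bigr => s _.
have := tperm_mul_involving s m ij.
by case: (s \in _); case: (_ \in _) => //=; [move=> -> | move=> -> | move=> <-].
Qed.

Lemma card_involutions_moving (k : nat) : (k.*2 <= #|T|)%N ->
  (#|involutions_moving k.*2| * (2 ^ k * k`! * (#|T| - k.*2)`!) = #|T|`!)%N.
Proof.
elim: k => [|k IHk] kT.
  suff -> : involutions_moving 0 = [set 1%g] by rewrite cards1 subn0 !mul1n.
  apply/setP => s; rewrite !inE cards_eq0; apply/andP/eqP => [[_ /eqP s1]|->].
    apply/permP => i; rewrite perm1; apply/eqP; apply: contraT => si.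
    by have := in_set0 i; rewrite -s1 inE si.
  by split; [rewrite mulg1 | apply/eqP/setP => i; rewrite !inE perm1 eqxx].
have kT' : (k.*2.+2 <= #|T|)%N by rewrite -doubleS.
rewrite -[RHS]IHk; last by lia.
have := card_involutions_moving_rec k.*2; rewrite doubleS.
(* In this form the factorial unfolds twice and yields the two factors of the recurrence. *)
have -> : (#|T| - k.*2)%N = (#|T| - k.*2.+2).+2 by lia.
rewrite expnS !factS => /= H.
have -> a b c d : (a * (2 * b * (k.+1 * c) * d) = (a * k.*2.+2) * (b * c * d))%N.
  by rewrite -doubleS -mul2n; lia.
by rewrite H; lia.
Qed.

End CountInvolutions.

(** * Ascents as representatives of 2-cycles *)

Section Ascents.
Variable n : nat.
Implicit Types (s : {perm 'I_n}).

Definition ascents s : {set 'I_n} := [set i : 'I_n | (i < s i)%N].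

(** Each 2-cycle contains exactly one ascent, its smaller element; hence the moved points are the
    disjoint union of the ascents and their images. *)
Lemma card_moved_involution s :
  (s * s == 1)%g -> #|moved s| = #|ascents s|.*2.
Proof.
move=> /involP ss; rewrite -addnn -{2}(card_imset (mem (ascents s)) (@perm_inj _ s)).
have -> : moved s = ascents s :|: s @: ascents s.
  apply/setP => i; rewrite !inE -[i in X in _ || X]ss.
  by rewrite (mem_imset _ _ (@perm_inj _ s)) inE ss -neq_ltn eq_sym.
rewrite cardsU disjoint_setI0 ?cards0 ?subn0 //.
apply/pred0P => i /=; rewrite inE -[i in X in _ && X]ss.
by rewrite (mem_imset _ _ (@perm_inj _ s)) inE ss; case: ltngtP.
Qed.

End Ascents.

(** * Coloured permutations as pairs [(s, z)], and their statistics *)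

Section ColouredPermutations.
Variables r n : nat.
Implicit Types (s : {perm 'I_n}) (z : {ffun 'I_n -> colour r}).

Lemma colour_act_inj s z :
  injective (fun x : letter r n => (s x.1, x.2 + z x.1) : letter r n).
Proof.
move=> [i c] [j d] /= e; have /= /perm_inj ij := congr1 fst e.
by have /= := congr1 snd e; rewrite ij => /addIr ->.
Qed.

Definition coloured_perm s z : {perm letter r n} := perm (@colour_act_inj s z).

Lemma coloured_permE s z i c : coloured_perm s z (i, c) = (s i, c + z i).
Proof. by rewrite permE. Qed.

Lemma abs_coloured_perm s z : abs_fun (coloured_perm s z) =1 s.
Proof. by case: (coloured_permsE (coloured_permE s z)). Qed.

Lemma col_coloured_perm s z : Defs.col (coloured_perm s z) =1 z.
Proof. by case: (coloured_permsE (coloured_permE s z)). Qed.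

Lemma coloured_permsP (sigma : {perm letter r n}) :
  reflect (exists s z, sigma = coloured_perm s z) (sigma \in coloured_perms r n).
Proof.
rewrite inE; apply: (iffP existsP) => [[s /existsP[z /forallP sz]]|[s [z ->]]].
  exists s, z; apply/permP => -[i c]; rewrite coloured_permE.
  by apply/eqP; move/forallP: (sz i); apply.
exists s; apply/existsP; exists z.
by apply/forallP => i; apply/forallP => c; rewrite coloured_permE.
Qed.

Lemma coloured_perm_inj s1 s2 z1 z2 :
  coloured_perm s1 z1 = coloured_perm s2 z2 -> s1 = s2 /\ z1 = z2.
Proof.
move=> e; split; [apply/permP => i | apply/ffunP => i].
  by rewrite -(abs_coloured_perm s1 z1) e abs_coloured_perm.
by rewrite -(col_coloured_perm s1 z1) e col_coloured_perm.
Qed.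

(** The square sends [(i, c)] to [(s (s i), c + z i + z (s i))]. *)
Lemma coloured_perm_involution s z :
  (coloured_perm s z * coloured_perm s z == 1)%g =
  (s * s == 1)%g && [forall i, z (s i) == - z i].
Proof.
apply/involP/andP => [ss|[/involP ss /forallP zs] [i c]]; last first.
  by rewrite !coloured_permE ss (eqP (zs i)) addrK.
have {}ss i : (s (s i), z i + z (s i)) = (i, 0).
  by rewrite -[RHS]ss !coloured_permE add0r.
split; first by apply/involP => i; case: (ss i).
by apply/forallP => i; rewrite -addr_eq0 addrC; apply/eqP/(congr1 snd (ss i)).
Qed.

Lemma sum_involutions (R : nmodType) (F : {perm letter r n} -> R) :
  \sum_(sigma in involutions r n) F sigma =
  \sum_(s : {perm 'I_n} | (s * s == 1)%g)
    \sum_(z : {ffun 'I_n -> colour r} | [forall i, z (s i) == - z i])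
      F (coloured_perm s z).
Proof.
rewrite pair_big_dep /=.
pose P := [set p : {perm 'I_n} * {ffun 'I_n -> colour r} |
  (p.1 * p.1 == 1)%g && [forall i, p.2 (p.1 i) == - p.2 i]].
have -> : involutions r n = [set coloured_perm p.1 p.2 | p in P].
  apply/setP => sigma; rewrite inE.
  apply/andP/imsetP => [[/coloured_permsP[s [z ->]]]|[[s z]]].
    by rewrite coloured_perm_involution => sz; exists (s, z); rewrite // inE.
  rewrite inE /= => sz ->; rewrite coloured_perm_involution.
  by split=> //; apply/coloured_permsP; exists s, z.
rewrite big_imset /=; first by apply: eq_bigl => p; rewrite inE.
by move=> [s1 z1] [s2 z2] _ _ /= /coloured_perm_inj[-> ->].
Qed.

Lemma fixn_coloured_perm s z : fixn (coloured_perm s z) = #|~: moved s|.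
Proof.
by apply: eq_card => i; rewrite !inE negbK abs_coloured_perm.
Qed.

Lemma csum_coloured_perm s z : csum (coloured_perm s z) = (\sum_i z i)%N.
Proof. by apply: eq_bigr => i _; rewrite col_coloured_perm. Qed.

(** A letter of nonzero colour precedes every letter of colour 0, so an excedance needs
    [z i = 0]. *)
Lemma excA_coloured_perm s z :
  excA (coloured_perm s z) = #|[set i in ascents s | z i == 0]|.
Proof.
apply: eq_card => i; rewrite !inE coloured_permE add0r /colour_lt /=.
rewrite eq_sym andbCA andbC; congr (_ && _).
(* The bound [i < n.-1] follows from [i < s i < n]. *)
by apply: andb_idl; have := ltn_ord (s i); lia.
Qed.

End ColouredPermutations.

(** * Sums over the colours of one cycle *)

Section ColourWeights.
Variable r : nat.
Hypothesis r_gt0 : (0 < r)%N.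

Lemma sum_colour :
  \sum_(c : colour r) (if c == 0 then v else w ^+ r) = v + (r - 1)%N%:R * w ^+ r.
Proof.
rewrite (bigD1 0) //=; congr (_ + _).
rewrite (eq_bigr (fun=> w ^+ r)) => [|c /negbTE-> //].
rewrite sumr_const mulr_natl; congr (_ *+ _).
by have := cardC1 (0 : colour r); rewrite card_ord subn1.
Qed.

Lemma colour_add (c d : colour r) : (c + d : colour r) = ((c + d) %% r)%N :> nat.
(* For positive [r] the modulus [r.-1.+1] reduces to [r]. *)
Proof. by case: r r_gt0 c d. Qed.

Lemma ltn_colour (c : colour r) : (c < r)%N.
Proof. by case: r r_gt0 c => // r' _; apply: ltn_ord. Qed.

(** The sum of the representatives is a multiple of [r] below [2r], hence 0 or [r]. *)
Lemma colour_addN (c d : colour r) :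
  c + d = 0 -> (c + d)%N = (if c == 0%R then 0 else r)%N.
Proof.
move/(congr1 (@nat_of_ord _)); rewrite colour_add /= => cd.
have cr := ltn_colour c; have dr := ltn_colour d; rewrite -val_eqE /=.
case: eqP => c0.
  by move: cd; rewrite c0 !add0n modn_small.
have /dvdnP[[|[|q]]] : (r %| c + d)%N by apply/eqP.
- by rewrite mul0n; lia.
- by rewrite mul1n.
by rewrite !mulSn; lia.
Qed.

(** The solutions of [c + c = 0] are 0 and, for even [r], the colour [r./2]. *)
Lemma sum_colour_order2 : \sum_(c : colour r | c + c == 0) w ^+ c = mu r.
Proof.
rewrite (bigD1 0) /= ?addr0 // expr0 /mu.
have half (c : colour r) : (c + c == 0) && (c != 0) = (c.*2 == r)%N.
  apply/andP/eqP => [[/eqP/colour_addN + /negbTE c0]|cr].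
    by rewrite c0 addnn.
  split; last by apply: contraTneq r_gt0 => c0; rewrite -cr c0.
  by apply/eqP/val_inj; rewrite [LHS]colour_add addnn cr modnn.
rewrite (eq_bigl _ _ half); case: ifP => [odd_r|even_r].
  by rewrite big1 ?addr0 // => c /eqP cr; rewrite -cr odd_double in odd_r.
have hr : (r./2 < r.-1.+1)%N by rewrite prednK //; lia.
rewrite (big_pred1 (Ordinal hr)) //= => c.
by rewrite /= -val_eqE /=; lia.
Qed.

End ColourWeights.

(** * Colourings compatible with a fixed involution *)

Section ColouringsOfInvolution.
Variables r n : nat.
Hypothesis r_gt0 : (0 < r)%N.
Variable s : {perm 'I_n}.
Hypothesis ss : involutive s.
Implicit Types (f z : {ffun 'I_n -> colour r}).

(** One representative per cycle of [s], its least element. *)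
Let D : {set 'I_n} := [set i : 'I_n | (i <= s i)%N].

(** The contribution of the whole cycle of [i], for [i] in [D] of colour [c]; on a 2-cycle the other
    colour is [- c]. *)
Definition weight (i : 'I_n) (c : colour r) : {mpoly rat[3]} :=
  if i \in ascents s then if c == 0 then v else w ^+ r else w ^+ c.

Lemma colouring_weight z : (forall i, z (s i) = - z i) ->
  v ^+ #|[set i in ascents s | z i == 0]| * w ^+ (\sum_i z i)%N =
  \prod_(i in D) weight i (z i).
Proof.
move=> zs.
have -> : (\sum_i z i =
  \sum_(i in D) (if i \in ascents s then z i + z (s i) else z i))%N.
  (* The points outside [D] are the images of the ascents; reindexing by [s] moves their colours to
     the representatives. *)
  rewrite (bigID (mem D)) /= [X in (_ + X)%N](reindex_inj (@perm_inj _ s)) /=.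
  rewrite [X in (_ + X)%N](eq_bigl (fun i => (i \in D) && (i \in ascents s))).
    rewrite [X in (_ + X)%N]big_mkcondr -big_split /=.
    by apply: eq_bigr => i _; case: ifP => _; rewrite ?addn0.
  by move=> i; rewrite !inE ss -ltnNge andb_idl // => /ltnW.
have -> : [set i in ascents s | z i == 0] =
          [set i in D | (i \in ascents s) && (z i == 0)].
  by apply/setP => i; rewrite !inE andbA (andb_idl (@ltnW _ _)).
rewrite -prodr_const expr_sum.
rewrite (eq_bigl (fun i => (i \in D) && ((i \in ascents s) && (z i == 0)))).
  rewrite big_mkcondr -big_split; apply: eq_bigr => i _ /=; rewrite /weight.
  case: (i \in ascents s) => /=; last by rewrite mul1r.
  have /(colour_addN r_gt0)-> : z i + z (s i) = 0 by rewrite zs subrr.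
  by case: ifP; rewrite ?expr0 ?mulr1 ?mul1r.
by move=> i; rewrite inE.
Qed.

(** A compatible colouring is determined by its values on [D], which are chosen independently, so
    the sum factors over the cycles. *)
Lemma sum_colourings :
  \sum_(z : {ffun 'I_n -> colour r} | [forall i, z (s i) == - z i])
     v ^+ #|[set i in ascents s | z i == 0]| * w ^+ (\sum_i z i)%N =
  mu r ^+ #|~: moved s| * (v + (r - 1)%N%:R * w ^+ r) ^+ #|ascents s|.
Proof.
pose ok i (c : colour r) := (i \in ascents s) || (c + c == 0).
transitivity (\prod_(i in D) \sum_(c | ok i c) weight i c); last first.
  rewrite (bigID (mem (ascents s))) /= [LHS]mulrC; congr (_ * _).
    rewrite -prodr_const; apply: eq_big => [i|i /andP[_ /negbTE ia]].
      by rewrite !inE negbK -leqNgt -eqn_leq eq_sym.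
    rewrite -(sum_colour_order2 r_gt0) /ok /weight ia; exact: eq_bigr.
  rewrite -prodr_const; apply: eq_big => [i|i /andP[_ ia]].
    by rewrite !inE andb_idl // => /ltnW.
  by rewrite -sum_colour /ok /weight ia.
(* Expanding the product gives families on [D], extended by the default colour 0 elsewhere; [ext]
   and [restr] translate between them and compatible colourings. *)
rewrite (big_distr_big_dep 0) /=.
pose ext f := [ffun i => if i \in D then f i else - f (s i)].
pose restr z := [ffun i => if i \in D then z i else 0 : colour r].
have Ds i : i \notin D -> s i \in D by rewrite !inE ss -ltnNge => /ltnW.
rewrite (reindex_onto ext restr) /=; last first.
  move=> z /forallP zs; apply/ffunP => i; rewrite !ffunE.
  by case: (boolP (i \in D)) => // /Ds ->; rewrite (eqP (zs i)) opprK.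
apply: eq_big => [f|f /andP[/forallP zs _]]; last first.
  rewrite colouring_weight => [|i]; last exact/eqP.
  by apply: eq_bigr => i iD; rewrite ffunE iD.
apply/andP/pfamilyP => [[/forallP zs /eqP <-]|[supp fok]].
  split.
    apply/subsetP => i; rewrite inE ffunE; case: ifP => //.
  move=> i iD; rewrite unfold_in /ok ffunE iD.
  case: (boolP (i \in ascents s)) => //= ia.
  have si : s i = i.
    by apply/val_inj/eqP; move: iD ia; rewrite !inE eqn_leq -leqNgt => -> ->.
  by have := zs i; rewrite si -addr_eq0.
split; last first.
  apply/eqP/ffunP => i; rewrite !ffunE; case: (boolP (i \in D)) => // iD.
  apply/esym/eqP; apply: contraNT iD => fi; exact: (subsetP supp).
apply/forallP => i; rewrite !ffunE ss; case: ifPn => [siD|/Ds].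
  (* Both [i] and [s i] lie in [D] only at a fixed point, where [ok] gives [c + c = 0]. *)
  case: ifPn => [iD|]; last by rewrite opprK.
  have si : s i = i.
    by apply/val_inj/eqP; move: iD siD; rewrite !inE ss eqn_leq => -> ->.
  have := fok i iD.
  by rewrite unfold_in /ok si inE si ltnn /= addr_eq0.
by rewrite ss => ->.
Qed.

End ColouringsOfInvolution.

(** * Grouping the involutions by their number of 2-cycles *)

Lemma card_involutions_movingE (n k : nat) : (k.*2 <= n)%N ->
  #|involutions_moving 'I_n k.*2|%:R =
  k`!%:R * multinomial3 n k k (n - k.*2) / 2 ^+ k :> rat.
Proof.
move=> kn; have fact_neq0 m : m`!%:R != 0 :> rat.
  by rewrite Num.Theory.pnatr_eq0 -lt0n fact_gt0.
have := @card_involutions_moving 'I_n k; rewrite card_ord => /(_ kn) H.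
rewrite /multinomial3 -H !natrM natrX; field.
by rewrite !fact_neq0 GRing.expf_neq0.
Qed.

Theorem corollary5p2 (r n : nat) (hr : (1 <= r)%N) (hn : (1 <= n)%N) :
  inv_poly r n =
  \sum_(uphalf n <= j < n.+1)
    ((n - j)`!%:R * multinomial3 n (n - j) (n - j) (2 * j - n)
       / 2 ^+ (n - j)) *:
    (u ^+ (2 * j - n) * (v + (r - 1)%N%:R * w ^+ r) ^+ (n - j)
       * mu r ^+ (2 * j - n)).
Proof.
pose X := v + (r - 1)%N%:R * w ^+ r.
transitivity (\sum_(s : {perm 'I_n} | (s * s == 1)%g)
    u ^+ #|~: moved s| * X ^+ #|ascents s| * mu r ^+ #|~: moved s|).
  rewrite /inv_poly sum_involutions; apply: eq_bigr => s /involP ss.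
  rewrite -mulrA [X ^+ _ * _]mulrC -(sum_colourings hr ss) mulr_sumr.
  apply: eq_bigr => z _.
  by rewrite fixn_coloured_perm excA_coloured_perm csum_coloured_perm mulrA.
have ascents_bound (s : {perm 'I_n}) : (s * s == 1)%g -> (#|ascents s|.*2 <= n)%N.
  by move=> ss; rewrite -card_moved_involution // -[leqRHS]card_ord max_card.
rewrite big_geq_mkord.
(* The index [j] is the number of cycles of [s]: there are [n - j] 2-cycles and [2 * j - n] fixed
   points. *)
rewrite (partition_big (fun s : {perm 'I_n} => inord (n - #|ascents s|) : 'I_n.+1)
           (fun j => (uphalf n <= j)%N)) /=; last first.
  move=> s /ascents_bound; move: #|_| => a ha.
  by rewrite inordK ?leq_uphalf_double; lia.
apply: eq_bigr => j; rewrite leq_uphalf_double => nj.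
have jn : (j <= n)%N by rewrite -ltnS.
have -> : (2 * j - n = n - (n - j).*2)%N by lia.
rewrite -card_involutions_movingE; last by lia.
(* The coefficient, now a cardinal, becomes a constant sum over the involutions moving [2 * (n - j)]
   points, to be compared termwise. *)
rewrite scaler_nat -sumr_const; apply: eq_big => [s|s].
  rewrite inE; case: (boolP (s * s == 1)%g) => //= ss.
  rewrite card_moved_involution // -val_eqE /=.
  by have := ascents_bound s ss; move: #|_| => a ha; rewrite inordK; lia.
case/andP => ss /eqP/(congr1 (@nat_of_ord _)).
rewrite inordK ?ltnS ?leq_subr // => exc_s.
have asc_s : #|ascents s| = (n - j)%N.
  by have := ascents_bound s ss; move: #|_| exc_s => a; lia.
have -> : #|~: moved s| = (n - (n - j).*2)%N.
  rewrite (@card_fixed _ _ (n - j).*2) ?card_ord // inE ss.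
  by rewrite card_moved_involution // asc_s eqxx.
by rewrite asc_s.
Qed.
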